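(* Let $p,q$ be distinct primes such that $p\nmid q-1$. Then every finite group in $\mathbf{A}_q\mathbf{A}_p$ has an integral.
   Context: For a group $H$, $H'$ denotes the derived group (commutator subgroup). An integral of a group $G$ is a group $H$ such that $H'\cong G$. For a positive integer $m$, $\mathbf{A}_m$ is the variety of abelian groups of exponent dividing $m$. The product variety $\mathbf{A}_q\mathbf{A}_p$ consists of all groups $G$ having a normal subgroup $N\in\mathbf{A}_q$ with $G/N\in\mathbf{A}_p$. *)

(* Defs.v *)
From mathcomp Require Import all_boot all_fingroup all_solvable.

Set Implicit Arguments.
Unset Strict Implicit.
Unset Printing Implicit Defensive.

Local Open Scope group_scope.

(* fingroup's [~: H, H] is only available for finite groups, whereas an integral
   may be infinite: this is the subgroup of H generated by all commutators. *)
Inductive derived (H : groupType) : H -> Prop :=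
| derived_comm (x y : H) : derived [~ x, y]
| derived_1 : derived 1
| derived_mul (x y : H) : derived x -> derived y -> derived (x * y)
| derived_inv (x : H) : derived x -> derived x^-1.

Definition iso_derived (gT : finGroupType) (G : {group gT}) (H : groupType) :=
  exists f : gT -> H,
    [/\ {in G &, {morph f : x y / x * y}},
        {in G &, injective f} &
        forall z : H, derived z <-> exists2 x, x \in G & f x = z].

Definition has_integral (gT : finGroupType) (G : {group gT}) :=
  exists H : groupType, iso_derived G H.

Definition in_A (m : nat) (gT : finGroupType) (G : {group gT}) : bool :=
  abelian G && (exponent G %| m).

Definition in_AA (q p : nat) (gT : finGroupType) (G : {group gT}) :=
  exists N : {group gT}, [/\ N <| G, in_A q N & in_A p (G / N)].

(* Main.v *)
Require Import Defs.
From mathcomp Require Import all_boot all_fingroup all_solvable.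
From mathcomp Require Import all_algebra all_field all_character.

(** Let N be the normal elementary abelian q-subgroup.  As p <> q, it has an
    elementary abelian p-complement P, so G = N ><| P, where N is a semisimple
    module over the field with q elements, with P acting.

    The key is an automorphism phi of G that acts on P by x |-> x ^+ q.  To extend
    the q-th power map of P to G is to find an additive bijection f of N with
    f (v ^ x) = f v ^ (x ^+ q).  On a cyclic summand of N, generated by v, the map
    v a |-> v (a ^+ q), for a in the commutative algebra spanned by P, has this
    property (twists_cyclic); it is the Frobenius map when the summand is
    irreducible and thus a field extension of F_q.  Maschke's theorem gives f on
    the whole of N (exists_unit_twist).

    If p does not divide q - 1, then the commutators [x, phi] = x ^+ q.-1 fill P,
    and with the commutators of G they generate P and [N, P].  Since N is the
    product of [N, P] and A = 'C_N(P), only the central subgroup A is left.  It is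
    supplied by replacing G with A x G and phi with (x, g) |-> (x, x * phi g),
    whose commutator with (x, 1) is (1, x).  The semidirect product of A x G with
    the cyclic group generated by this automorphism then has derived group 1 x G,
    and is an integral of G (has_integral_central_twist). *)

Set Implicit Arguments.
Unset Strict Implicit.
Unset Printing Implicit Defensive.

(** * Integrals from automorphisms *)

Section IntegralsFromAutomorphisms.
Local Open Scope group_scope.

Lemma derivedE (kT : finGroupType) (z : kT) :
  derived z <-> z \in [~: [set: kT], [set: kT]].
Proof.
split.
  by elim=> [x y||x y _ Dx _ Dy|x _ Dx];
     rewrite ?mem_commg ?groupM ?groupV ?in_setT.
case/gen_prodgP=> n [c Dc ->].
apply: big_ind => [||i _]; [exact: derived_1 | exact: derived_mul |].
by case/imset2P: (Dc i) => x y _ _ ->; apply: derived_comm.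
Qed.

Lemma has_integral_isog (gT kT : finGroupType) (G : {group gT}) :
  G \isog [~: [set: kT], [set: kT]] -> has_integral G.
Proof.
case/isogP=> f injf imf; exists kT, f; split.
- exact: morphM.
- exact: injmP.
move=> z; apply: (iff_trans (derivedE z)); rewrite -imf; split.
  by case/morphimP=> x Gx _ ->; exists x.
by case=> x Gx <-; apply: mem_morphim.
Qed.

(** The group generated is the derived group of R ><| <[a]>, in which r^-1 * a r is the
    commutator of r and a.  The subgroup M generated by these elements and the
    commutators of R is normalised by R, as it contains the derived group of
    R, and by a, as a r = r * (r^-1 * a r); modulo M, both R and <[a]> are
    abelian and they centralise each other. *)
Lemma has_integral_aut (gT rT : finGroupType) (G : {group gT})
    (R : {group rT}) (a : {perm rT}) :
    a \in Aut R ->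
    G \isog <<commg_set R R :|: [set r^-1 * a r | r in R]>> -> has_integral G.
Proof.
move=> AutRa; set S := _ :|: _ => isoGM; pose M := <<S>>%G; pose D := <[a]>%G.
have sDA : D \subset Aut R by rewrite cycle_subG.
have sMR : M \subset R.
  rewrite gen_subG subUset; apply/andP; split.
    by rewrite -gen_subG; apply: der_sub 1%N R.
  by apply/subsetP=> _ /imsetP[r Rr ->]; rewrite groupM ?groupV ?Aut_closed.
pose to := ([Aut R] \ sDA)%gact.
have Da : a \in D by apply: cycle_id.
have toE r : r \in R -> to r a = a r by [].
pose i1 := sdpair1_morphism to; pose i2 := sdpair2_morphism to.
have inj1 : 'injm i1 := injm_sdpair1 to.
suff defK : i1 @* M = [~: [set: sdprod_by to], [set: sdprod_by to]].
  apply: (@has_integral_isog _ (sdprod_by to)); rewrite -defK.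
  exact: isog_trans isoGM (sub_isog _ inj1).
have comm1 r : r \in R -> i1 (r^-1 * a r) = [~ i1 r, i2 a].
  move=> Rr; rewrite morphM ?groupV ?Aut_closed //= morphV //.
  by rewrite /i1 /i2 commgEl -sdpair_act.
have KE : [set: sdprod_by to] = i1 @* R <*> <[i2 a]>.
  rewrite -(morphim_cycle (sdpair2_morphism to)) //.
  by have /sdprodWY := sdprod_sdpair to.
apply/eqP; rewrite eqEsubset; apply/andP; split.
  rewrite morphim_gen ?(subset_trans (subset_gen S) sMR) //.
  rewrite gen_subG morphimU subUset; apply/andP; split.
    apply/subsetP=> _ /morphimP[x _ /imset2P[r s Rr Rs ->] ->].
    by rewrite morphR // mem_commg ?in_setT.
  apply/subsetP=> _ /morphimP[x _ /imsetP[r Rr ->] ->].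
  by rewrite comm1 // mem_commg ?in_setT.
have sR'M : R^`(1) \subset M by rewrite genS // subsetUl.
have mem_ag r : r \in R -> r^-1 * a r \in M.
  by move=> Rr; rewrite mem_gen // inE orbC (imset_f (fun r => r^-1 * a r)).
have nMR : i1 @* R \subset 'N(i1 @* M).
  by rewrite morphim_norms // sub_der1_norm.
have nMa : i2 a \in 'N(i1 @* M).
  rewrite inE; apply/subsetP=> _ /imsetP[_ /morphimP[g Rg Mg ->] ->].
  rewrite /i1 /i2 /= -sdpair_act //.
  apply: mem_morphim; first exact: Aut_closed.
  change (a g \in M).
  have -> : a g = g * (g^-1 * a g) by rewrite mulKVg.
  by rewrite groupM // mem_ag.
rewrite KE; apply: der1_min.
  by rewrite join_subG nMR cycle_subG.
rewrite quotientY ?cycle_subG // abelianY; apply/and3P; split.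
- by rewrite sub_der1_abelian // -[_^`(1)](morphim_der i1) // morphimS.
- by rewrite quotient_abelian ?cycle_abelian.
rewrite quotient_cycle // cycle_subG -sub1set -quotient_set1 // centsC.
apply: quotient_cents2r; rewrite gen_subG.
apply/subsetP=> _ /imset2P[_ _ /morphimP[r _ Rr ->] /set1P-> ->].
by rewrite -comm1 // mem_morphim ?mem_ag // groupM ?groupV ?Aut_closed.
Qed.

End IntegralsFromAutomorphisms.

(** * Twisting a module by the Frobenius map *)

Section FrobeniusTwist.
Import GRing.Theory.
Local Open Scope ring_scope.

Variables (q : nat) (F : fieldType).
Variables (gT : finGroupType) (G : {group gT}) (n : nat).
Hypotheses (charF : q \in [pchar F]) (FrobF : forall a : F, a ^+ q = a).
Hypotheses (abG : abelian G) (coGq : coprime #|G| q).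
Let q_pr : prime q := pcharf_prime charF.
Variable rG : mx_representation F G n.+1.

(** The image in the enveloping algebra of the element of the group ring F[G] with
    coefficients c, transported by the k-th power map of G. *)
Definition group_ring_mx (c : 'rV[F]_#|G|) (k : nat) : 'M[F]_n.+1 :=
  \sum_i c 0 i *: rG (enum_val i ^+ k)%g.

(** The enveloping algebra is commutative of characteristic q, so raising to the
    power q is additive in it, and fixes the scalars. *)
Lemma group_ring_mx_Frobenius c k :
  group_ring_mx c k ^+ q = group_ring_mx c (k * q).
Proof.
have charM : q \in [pchar 'M[F]_n.+1].
  by rewrite inE q_pr /= -scaler_nat pcharf0 // scale0r.
(* Additivity needs the partial sums to commute with the remaining terms. *)
pose P (a b : 'M[F]_n.+1) :=
  a ^+ q = b /\ {in G, forall x, GRing.comm a (rG x)}.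
suff [] : P (group_ring_mx c k) (group_ring_mx c (k * q)) by [].
apply: (big_rec2 P) => [|i a b _ [<- ca]].
  split; first by rewrite expr0n -(prednK (prime_gt0 q_pr)).
  by move=> x _; apply/commr_sym/commr0.
have Gi := enum_valP i.
have ci x : x \in G -> GRing.comm (c 0 i *: rG (enum_val i ^+ k)%g) (rG x).
  move=> Gx; rewrite /GRing.comm -scalerAl -scalerAr; congr (_ *: _).
  rewrite -[LHS]repr_mxM -1?[RHS]repr_mxM ?groupX //.
  by rewrite (centsP abG) ?groupX.
split; last by move=> x Gx; apply/commr_sym/commrD; apply/commr_sym; auto.
rewrite -!(pFrobenius_autE charM) pFrobenius_autD_comm; last first.
  have := ca _ (groupX k Gi).
  by rewrite /GRing.comm -scalerAl -scalerAr => ->.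
congr (_ + _); rewrite pFrobenius_autE exprZn -(repr_mxX rG) ?groupX // -expgM.
by rewrite FrobF.
Qed.

(** Phi restricts to an isomorphism from the submodule V to the module with the same
    vectors on which x acts as x ^+ q did. *)
Definition twists (V Phi : 'M[F]_n.+1) := forall u : 'rV_n.+1, (u <= V)%MS ->
  [/\ (u *m Phi <= V)%MS,
      {in G, forall x, u *m rG x *m Phi = u *m Phi *m rG (x ^+ q)%g} &
      u *m Phi = 0 -> u = 0].

(** On the cyclic module of v, send v a to v (a ^+ q), for a in the enveloping
    algebra.  This is well defined because v a = 0 implies v a ^+ q = 0; it is
    injective because some positive iterate of the Frobenius map fixes every
    element of the group, hence is the identity on the enveloping algebra. *)
Lemma twists_cyclic (v : 'rV_n.+1) : exists Phi, twists (cyclic_mx rG v) Phi.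
Proof.
pose B k := \matrix_(i < #|G|) (v *m rG (enum_val i ^+ k)%g).
have rowB k i : row i (B k) = v *m rG (enum_val i ^+ k)%g by exact: rowK.
have BE c k : c *m B k = v *m group_ring_mx c k.
  rewrite mulmx_sum_row mulmx_sumr; apply: eq_bigr => i _.
  by rewrite rowB scalemxAr.
have frob (c : 'rV_#|G|) k : c *m B k = 0 -> c *m B (k * q)%N = 0.
  have expS (a : 'M[F]_n.+1) : a ^+ q = a *m a ^+ q.-1.
    by rewrite -[RHS]exprS prednK ?prime_gt0.
  by rewrite !BE -group_ring_mx_Frobenius expS mulmxA => ->; rewrite mul0mx.
(* Phi exists because the left kernel of B 1 is contained in that of B q. *)
have kerB : (1%:M - B 1%N *m pinvmx (B 1%N)) *m B q = 0.
  apply/row_matrixP => i; rewrite row_mul row0.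
  have -> : B q = B (1 * q)%N by rewrite mul1n.
  apply: frob.
  by rewrite -row_mul mulmxBl mul1mx mulmxKpV // subrr row0.
pose Phi := pinvmx (B 1%N) *m B q.
have BPhi : B 1%N *m Phi = B q.
  by apply/esym/eqP; rewrite -subr_eq0 mulmxA -{1}(mul1mx (B q)) -mulmxBl kerB.
have PhiE x : x \in G -> v *m rG x *m Phi = v *m rG (x ^+ q)%g.
  move=> Gx; have := congr1 (row (enum_rank_in Gx x)) BPhi.
  by rewrite row_mul !rowB enum_rankK_in.
have cycE (u : 'rV_n.+1) : (u <= cyclic_mx rG v)%MS -> exists c, u = c *m B 1%N.
  case/cyclic_mxP=> a /envelop_mxP [c ->] ->.
  exists (\row_i c (enum_val i)).
  rewrite BE; congr (v *m _); rewrite big_enum_val.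
  by apply: eq_bigr => i _; rewrite mxE.
have cyc k (c : 'rV_#|G|) : (c *m B k <= cyclic_mx rG v)%MS.
  rewrite BE; apply/cyclic_mxP; exists (group_ring_mx c k) => //.
  rewrite linear_sum summx_sub // => i _.
  by rewrite linearZ scalemx_sub // envelop_mx_id // groupX ?enum_valP.
exists Phi => u /cycE [c ->]; rewrite -mulmxA BPhi; split.
- exact: cyc.
- move=> x Gx.
  suff BJ : B 1%N *m rG x *m Phi = B q *m rG (x ^+ q)%g.
    by rewrite -(mulmxA c) -(mulmxA c) BJ mulmxA.
  apply/row_matrixP => i; have Gi := enum_valP i; rewrite !row_mul !rowB.
  have vM y z : y \in G -> z \in G -> v *m rG y *m rG z = v *m rG (y * z)%g.
    by move=> Gy Gz; rewrite repr_mxM // mulmxA.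
  rewrite !vM ?groupX // expg1.
  by rewrite PhiE ?groupM // expgMn //; apply: (centsP abG).
(* Injectivity: q ^ totient #|G| is 1 modulo #|G|. *)
have BX m : c *m B q = 0 -> c *m B (q ^ m.+1)%N = 0.
  by move=> cB; elim: m => // m /frob; rewrite -expnSr.
move/(BX (totient #|G|).-1); rewrite prednK ?totient_gt0 ?cardG_gt0 // => <-.
congr (c *m _); apply/row_matrixP => i; rewrite !rowB.
congr (v *m rG _).
rewrite -[LHS](expg_mod _ (expg_cardG (enum_valP i))).
rewrite -[RHS](expg_mod _ (expg_cardG (enum_valP i))).
by rewrite Euler_exp_totient // coprime_sym.
Qed.

Lemma twists_addsmx (U V PhiU PhiV : 'M[F]_n.+1) :
    mxmodule rG U -> mxmodule rG V -> (U :&: V = 0)%MS ->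
    twists U PhiU -> twists V PhiV ->
  twists (U + V)%MS (proj_mx U V *m PhiU + proj_mx V U *m PhiV).
Proof.
move=> modU modV dxUV tU tV; have dxVU : (V :&: U = 0)%MS by rewrite capmxC.
set Phi := _ + _.
have PhiE (u v : 'rV_n.+1) : (u <= U)%MS -> (v <= V)%MS ->
  (u + v) *m Phi = u *m PhiU + v *m PhiV.
  move=> Uu Vv; rewrite /Phi mulmxDl !mulmxDr !(mulmxA _ (proj_mx _ _)).
  rewrite (proj_mx_id dxUV Uu) (proj_mx_0 dxVU Uu).
  rewrite (proj_mx_id dxVU Vv) (proj_mx_0 dxUV Vv).
  by rewrite !mul0mx addr0 add0r.
move=> w /sub_addsmxP [[a b] /= ->].
have Uu : (a *m U <= U)%MS by exact: submxMl.
have Vv : (b *m V <= V)%MS by exact: submxMl.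
move: (a *m U) (b *m V) Uu Vv => u v Uu Vv.
have [Uu' tu nu] := tU u Uu; have [Vv' tv nv] := tV v Vv.
rewrite PhiE //; split.
- by rewrite addmx_sub_adds.
- move=> x Gx; rewrite mulmxDl PhiE ?mxmodule_trans //.
  by rewrite tu // tv // mulmxDl.
move=> uv0.
have u0 : u *m PhiU = 0.
  apply/eqP; rewrite -submx0 -dxUV sub_capmx Uu' /=.
  by rewrite -[u *m _]opprK (addr0_eq uv0) eqmx_opp.
by move: uv0; rewrite u0 add0r => /nv ->; rewrite nu ?addr0.
Qed.

(** By Maschke's theorem a submodule that is not everything has a complement, from
    which one more cyclic summand can be split off: the twists of the cyclic
    summands assemble into a twist of the whole module. *)
Lemma exists_unit_twist : exists2 Phi, Phi \in unitmx &
  {in G, forall x (u : 'rV_n.+1),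
     u *m rG x *m Phi = u *m Phi *m rG (x ^+ q)%g}.
Proof.
suff [Phi tPhi] : exists Phi, twists 1%:M Phi.
  exists Phi.
    rewrite -row_free_unit; apply/inj_row_free => u.
    by case: (tPhi u (submx1 u)).
  by move=> x Gx u; have [_ ->] := tPhi u (submx1 u).
suff subtwist k : (k <= n.+1)%N -> exists V : 'M_n.+1,
    [/\ mxmodule rG V, (k <= \rank V)%N & exists Phi, twists V Phi].
  have [V [_ rV [Phi tPhi]]] := subtwist _ (leqnn n.+1); exists Phi => u _.
  have V1 : (1%:M <= V)%MS by rewrite sub1mx -col_leq_rank.
  have [_ ? ?] := tPhi u (submx_trans (submx1 u) V1).
  by split=> //; apply: submx1.
elim: k => [_|k IHk lt_k].
  exists 0; split=> //; first exact: mxmodule0.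
  exists 0 => u; rewrite submx0 => /eqP ->;
   split=> [|x _|] //; rewrite ?mul0mx ?sub0mx // mul0mx.
have [V [modV rV [Phi tPhi]]] := IHk (ltnW lt_k).
have [gtV | leV] := ltnP k (\rank V); first by exists V; split=> //; exists Phi.
have F'G : pgroup [pchar F]^' G.
  rewrite /pgroup (eq_pnat _ (eq_negn (pcharf_eq charF))).
  by rewrite p'natE // -prime_coprime // coprime_sym.
have [W modW defVW dxVW] := mx_Maschke_pchar rG F'G modV (submx1 V).
have ntW : W != 0.
  apply: contraTneq lt_k => W0; rewrite -leqNgt.
  by rewrite -(mxrank1 F n.+1) -defVW W0 addsmx0.
pose w := nz_row W; have Ww : (w <= W)%MS by exact: nz_row_sub.
have sCW : (cyclic_mx rG w <= W)%MS by apply: cyclic_mx_sub.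
have dxVC : (V :&: cyclic_mx rG w = 0)%MS.
  apply/eqP; rewrite -submx0; apply: submx_trans (capmxS (submx_refl V) sCW) _.
  by rewrite (mxdirect_addsP dxVW).
have [Psi tPsi] := twists_cyclic w.
exists (V + cyclic_mx rG w)%MS; split.
- by rewrite addsmx_module ?cyclic_mx_module.
- rewrite (mxdirectP _) /=; last by apply/mxdirect_addsP.
  rewrite -addn1 leq_add // lt0n mxrank_eq0 cyclic_mx_eq0.
  by rewrite nz_row_eq0.
- by eexists; apply: twists_addsmx tPhi tPsi; rewrite ?cyclic_mx_module.
Qed.

End FrobeniusTwist.

(** * Extending the power map of a complement *)

Section PowerMap.
Import GRing.Theory.
Local Open Scope group_scope.

(** The lemma exists_unit_twist read in a normal elementary abelian group,
    regarded as a vector space over its prime field. *)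
Lemma exists_power_twist q (gT : finGroupType) (N P : {group gT}) :
    prime q -> q.-abelem N -> abelian P -> coprime #|P| q -> P \subset 'N(N) ->
  exists f : {morphism N >-> gT}, [/\ 'injm f, f @* N = N &
    {in N & P, forall v x, f (v ^ x) = f v ^ (x ^+ q)}].
Proof.
move=> q_pr abelN abP coPq nNP; have [N1 | ntN] := eqVneq (N : {set gT}) 1.
  exists (idm_morphism N); rewrite injm_idm im_idm; split=> // v x.
  by rewrite N1 => /set1P -> _ /=; rewrite !conj1g.
have FrobF (c : 'F_q) : (c ^+ q)%R = c.
  by rewrite -[RHS]expf_card card_Fp.
have [Phi uPhi PhiE] := exists_unit_twist (pchar_Fp q_pr) FrobF abP coPq
                          (abelem_repr abelN ntN nNP).
pose h v := rVabelem abelN ntN (abelem_rV abelN ntN v *m Phi)%R.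
have hM : {in N &, {morph h : u v / u * v}}.
  by move=> u v Nu Nv; rewrite /h abelem_rV_M // mulmxDl rVabelemD.
pose f := Morphism hM.
have injf : 'injm f.
  apply/injmP=> u v Nu Nv /rVabelem_inj /(can_inj (mulmxK uPhi)).
  exact: abelem_rV_inj.
exists f; split=> //.
  apply/morphim_fixP=> //; apply/subsetP=> _ /morphimP[v _ _ ->].
  exact: mem_rVabelem.
move=> v x Nv Px /=.
rewrite /h (abelem_rV_J abelN ntN nNP) // PhiE //.
by rewrite rVabelemJ ?groupX.
Qed.

(** The twist on N and the map x |-> x ^+ q on P glue together: the relation
    f (v ^ x) = f v ^ (x ^+ q) is exactly their compatibility. *)
Lemma exists_sdprod_power_aut q (gT : finGroupType) (N P G : {group gT}) :
    prime q -> q.-abelem N -> abelian P -> coprime #|P| q -> N ><| P = G ->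
  exists phi : {morphism G >-> gT},
    [/\ 'injm phi, phi @* G = G & {in P, forall x, phi x = x ^+ q}].
Proof.
move=> q_pr abelN abP coPq defG; have [_ _ nNP tiNP] := sdprodP defG.
have [f [injf imf fJ]] := exists_power_twist q_pr abelN abP coPq nNP.
have gM : {in P &, {morph (fun x => x ^+ q) : x y / x * y}}.
  by move=> x y Px Py /=; rewrite expgMn //; apply: (centsP abP).
pose g := Morphism gM.
have injg : 'injm g by apply/injmP/(can_in_inj (expgK coPq)).
have img : g @* P = P.
  apply/morphim_fixP=> //; apply/subsetP=> _ /morphimP[x _ Px ->].
  exact: groupX.
have fgJ : {in N & P, morph_act 'J 'J f g} by [].
exists (sdprodm_morphism defG fgJ); split=> [||x Px].
- by rewrite injm_sdprodm injf injg imf img tiNP eqxx.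
- by rewrite im_sdprodm imf img (sdprodW defG).
- by rewrite /= sdprodmEr.
Qed.

(** P acts trivially on N / [~: N, P], and in coprime action fixed points lift from
    a quotient. *)
Lemma coprime_abelian_comm_cent (gT : finGroupType) (N P : {group gT}) :
    P \subset 'N(N) -> coprime #|N| #|P| -> abelian N ->
  N \subset [~: N, P] * 'C_N(P).
Proof.
move=> nNP coNP abN; have nRN := commg_norml N P.
rewrite -quotientSK //.
rewrite coprime_quotient_cent ?abelian_sol ?commg_subl ?commg_normr //.
by rewrite subsetI subxx quotient_cents2r.
Qed.

(** The elements g^-1 * phi g need not reach a central subgroup A.  The
    automorphism (x, g) |-> (x, x * phi g) of A x G repairs this: its commutator
    with (x, 1) is (1, x), and its commutator with (1, g) is (1, g^-1 * phi g).
    As A is abelian, all commutators have trivial first coordinate, so the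
    extension of A x G by this automorphism has derived group 1 x G. *)
Lemma has_integral_central_twist (gT : finGroupType) (A G : {group gT})
    (phi : {morphism G >-> gT}) :
    'injm phi -> phi @* G = G -> A \subset 'Z(G) ->
    G \subset <<commg_set G G :|: A :|: [set g^-1 * phi g | g in G]>> ->
  has_integral G.
Proof.
move=> injphi imphi sAZ genG.
have sAG : A \subset G := subset_trans sAZ (center_sub G).
have cAG : {in A & G, forall x y, commute x y}.
  by move=> x y Ax Gy; have /centerP[_ cxG] := subsetP sAZ x Ax; exact: cxG.
have Gphi g : g \in G -> phi g \in G.
  by move=> Gg; have := mem_morphim phi Gg Gg; rewrite imphi.
pose R := setX_group A G; pose h (u : gT * gT) := (u.1, u.1 * phi u.2).
have RE x g : ((x, g) \in R) = (x \in A) && (g \in G) by rewrite inE.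
have hM : {in R &, {morph h : u v / u * v}}.
  case=> [x g] [y k]; rewrite !RE => /andP[Ax Gg] /andP[Ay Gk].
  congr (_, _); rewrite /= morphM // !mulgA; congr (_ * _).
  by rewrite -!mulgA (cAG y) ?Gphi.
pose hm := Morphism hM.
have injh : 'injm hm.
  apply/injmP=> [[x g] [y k]]; rewrite !RE => /andP[Ax Gg] /andP[Ay Gk] /=.
  by case=> -> /mulgI/(injmP injphi _ _ Gg Gk) ->.
have imh : hm @* R = R.
  apply/morphim_fixP=> //; apply/subsetP=> _ /morphimP[[x g] _ Rxg ->].
  move: Rxg; rewrite !RE => /andP[Ax Gg].
  by rewrite Ax groupM ?Gphi // (subsetP sAG).
apply: (has_integral_aut (Aut_aut injh imh)).
set S := _ :|: _.
have S_move x g : x \in A -> g \in G -> (1, g^-1 * (x * phi g)) \in S.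
  move=> Ax Gg; have Rxg : (x, g) \in R by rewrite RE Ax.
  rewrite inE; apply/orP; right; apply/imsetP; exists (x, g) => //.
  by rewrite autE //; congr (_, _); rewrite /= mulVg.
pose i2 := pair1g_morphism gT gT.
suff -> : <<S>> = i2 @* G by exact: sub_isog (subsetT _) (injm_pair1g _ _).
have i2E g : g \in G -> (1, g) \in i2 @* G.
  by move=> Gg; have := mem_morphim i2 (in_setT g) Gg.
apply/eqP; rewrite eqEsubset gen_subG subUset -andbA; apply/and3P; split.
- apply/subsetP=> _ /imset2P[[x g] [y k] Rxg Ryk ->].
  move: Rxg Ryk; rewrite !RE => /andP[Ax Gg] /andP[Ay Gk].
  have -> : [~ (x, g), (y, k)] = ([~ x, y], [~ g, k]) by [].
  have /commgP/eqP-> := cAG x y Ax (subsetP sAG y Ay).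
  by rewrite i2E ?groupR.
- apply/subsetP=> _ /imsetP[[x g] Rxg ->].
  rewrite autE //; move: Rxg; rewrite RE => /andP[Ax Gg].
  have -> : (x, g)^-1 * hm (x, g) = (1, g^-1 * (x * phi g)).
    by congr (_, _); rewrite /= mulVg.
  by rewrite i2E ?groupM ?groupV ?Gphi // (subsetP sAG).
rewrite sub_morphim_pre ?subsetT //; apply: subset_trans genG _.
have preE g : (g \in i2 @*^-1 <<S>>) = ((1, g) \in <<S>>).
  by rewrite !inE.
rewrite gen_subG !subUset -andbA; apply/and3P; split; apply/subsetP=> g.
- case/imset2P=> x y Gx Gy ->; rewrite preE mem_gen // inE.
  apply/orP; left; apply/imset2P.
  exists (1, x) (1, y); rewrite ?RE ?group1 //.
  have -> : [~ (1 : gT, x), (1 : gT, y)] = ([~ 1, 1], [~ x, y]) by [].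
  by rewrite comm1g.
- move=> Ag; rewrite preE mem_gen //.
  by have := S_move g 1 Ag (group1 G); rewrite morph1 invg1 mul1g mulg1.
case/imsetP=> x Gx ->; rewrite preE mem_gen //.
by have := S_move 1 x (group1 A) Gx; rewrite mul1g.
Qed.

(** The three generating sets of the preceding criterion cover G: N is the product
    of [~: N, P] and the central subgroup 'C_N(P), and P consists of (q - 1)-st
    powers x ^+ q.-1 = x^-1 * phi x. *)
Lemma has_integral_sdprod q (gT : finGroupType) (N P G : {group gT}) :
    prime q -> q.-abelem N -> abelian P -> coprime #|P| q ->
    coprime #|P| q.-1 -> N ><| P = G ->
  has_integral G.
Proof.
move=> q_pr abelN abP coPq coPq1 defG.
have [phi [injphi imphi phiP]] :=
  exists_sdprod_power_aut q_pr abelN abP coPq defG.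
have [_ defNP nNP _] := sdprodP defG.
have [sNG sPG] := mulG_sub defNP.
have abN := abelem_abelian abelN.
have coNP : coprime #|N| #|P|.
  apply: pnat_coprime (abelem_pgroup abelN) _.
  by rewrite p'natE // -prime_coprime // coprime_sym.
have sNRC := coprime_abelian_comm_cent nNP coNP abN.
apply: (has_integral_central_twist (A := 'C_N(P)) injphi imphi).
  rewrite subsetI subIset ?sNG //= -defNP centM subsetI subsetIr andbT.
  exact: subset_trans (subsetIl _ _) abN.
set S := _ :|: _; rewrite -{1}defNP mul_subG //.
  apply: subset_trans sNRC _; rewrite mul_subG //.
    rewrite genS //; apply: subset_trans (imset2S _ sNG sPG) _.
    by rewrite /S -setUA subsetUl.
  by rewrite sub_gen // /S -setUA setUCA subsetUl.
apply/subsetP=> x Px.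
(* x is a power of x^-1 * phi x = x ^+ q.-1, as q - 1 is prime to #|P|. *)
rewrite -(expgK coPq1 Px) groupX // mem_gen //.
rewrite inE; apply/orP; right; apply/imsetP.
exists x; first exact: (subsetP sPG).
by rewrite phiP // -[in RHS](prednK (prime_gt0 q_pr)) expgS mulKg.
Qed.

End PowerMap.

Theorem theorem6p9 (p q : nat) (p_pr : prime p) (q_pr : prime q)
    (neq_pq : p <> q) (p_ndvd : ~ (p %| q - 1))
    (gT : finGroupType) (G : {group gT}) :
  in_AA q p G -> has_integral G.
Proof.
case=> N [nsNG]; rewrite /in_A -!abelemE // => abelN abelGN.
have coprime_qp m n : q.-nat m -> p.-nat n -> coprime m n.
  move=> qm pn; apply: pnat_coprime qm (pi_pnat pn _).
  by rewrite !inE; apply/eqP.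
have hallN : Hall G N.
  rewrite /Hall normal_sub // -card_quotient ?normal_norm //.
  exact: coprime_qp (abelem_pgroup abelN) (abelem_pgroup abelGN).
have [P /complP[tiNP defNP]] := splitsP (SchurZassenhaus_split hallN nsNG).
have [sNG sPG] := mulG_sub defNP.
have nNP : (P \subset 'N(N))%g := subset_trans sPG (normal_norm nsNG).
have defG : (N ><| P = G)%g by rewrite sdprodE.
have abelP : (p.-abelem P)%g by rewrite (isog_abelem (sdprod_isog defG)).
have abP := abelem_abelian abelP.
have coPq : coprime #|P| q.
  by rewrite coprime_sym coprime_qp ?pnat_id // -/(pgroup _ _) abelem_pgroup.
apply: has_integral_sdprod q_pr abelN abP coPq _ defG.
apply: pnat_coprime (abelem_pgroup abelP) _.
by rewrite p'natE // -subn1; apply/negP.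
Qed.
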